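(* Let $n\ge1$ be an integer and let $q$ be a prime power with $q\equiv1\pmod 4$. Then the set of coherent triples of elements of $\mathcal V$ forms a two-graph $\Delta_\sigma$ on $\mathcal V$, and this two-graph is invariant under the natural action of $P\Sigma Sp(2n,q)$ on $\mathcal V$.
   Context: $V$ is a $2n$-dimensional vector space over $\mathbb F_q$ with a nondegenerate alternating bilinear form $B$. $\mathcal V$ is the set of all $n$-dimensional totally isotropic subspaces of $V$. For $X,Y\in\mathcal V$ put $d(X,Y)=n-\dim(X\cap Y)$. $\chi:\mathbb F_q^\times\to\{\pm1\}$ is the quadratic character. For each $X\in\mathcal V$ fix a determinant function $\delta_X$, i.e. a nonzero alternating $n$-linear form $X^n\to\mathbb F_q$. For $X\ne Y$ in $\mathcal V$ with $d(X,Y)=k$, choose bases $x_1,\dots,x_n$ of $X$ and $y_1,\dots,y_n$ of $Y$ such that $x_i=y_i$ for $k<i\le n$ form a basis of $X\cap Y$, and put $$\sigma(X,Y)=\chi\bigl(\delta_X(x_1,\dots,x_n)\,\delta_Y(y_1,\dots,y_n)\det[B(x_i,y_j):1\le i,j\le k]\bigr);$$ this does not depend on the chosen bases. For distinct $X,Y,Z\in\mathcal V$ put $\sigma(X,Y,Z)=\sigma(X,Y)\sigma(Y,Z)\sigma(Z,X)$; the triple $(X,Y,Z)$ is coherent if $\sigma(X,Y,Z)=1$ and non-coherent if $\sigma(X,Y,Z)=-1$. When $q\equiv1\pmod4$, $\sigma(X,Y)=\sigma(Y,X)$, so coherence is a property of the unordered triple $\{X,Y,Z\}$. A two-graph on a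 set $\mathcal V$ is a set $\Delta$ of $3$-subsets of $\mathcal V$ such that every $4$-subset of $\mathcal V$ contains an even number of members of $\Delta$. $\Sigma Sp(2n,q)$ is the group of semi-isometries of $B$: invertible semilinear maps $g$ of $V$, with associated field automorphism $\tau_g\in\mathrm{Aut}\,\mathbb F_q$, such that $B(x^g,y^g)=B(x,y)^{\tau_g}$ for all $x,y\in V$; $P\Sigma Sp(2n,q)=\Sigma Sp(2n,q)/\langle-I\rangle$, acting on $\mathcal V$ by $X\mapsto X^g$. *)

(* Defs.v *)
From HB Require Import structures.
From mathcomp Require Import all_boot all_order all_algebra all_fingroup.
From mathcomp Require Import all_solvable all_field.

Set Implicit Arguments.
Unset Strict Implicit.
Unset Printing Implicit Defensive.

Import GRing.Theory.
Local Open Scope ring_scope.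

(* The subspaces of a finite vector space form a finite type; a subspace is   *)
(* recovered from its set of vectors by taking the span.                      *)
Section FiniteSubspaces.

Variables (F : finFieldType) (vT : vectType F).
Local Notation V := (finvect_type vT).

Definition vspace_set (X : {vspace V}) : {set V} := [set x in X].

Lemma vspace_setK :
  cancel vspace_set (fun A : {set V} => <<enum A>>%VS : {vspace V}).
Proof.
move=> X; apply/eqP; rewrite eqEsubv; apply/andP; split.
  by apply/span_subvP => x; rewrite mem_enum inE.
by apply/subvP => x Xx; apply: memv_span; rewrite mem_enum inE.
Qed.

HB.instance Definition _ := isCountable.Build {vspace V}
  (pcan_pickleK (can_pcan vspace_setK)).
HB.instance Definition _ := isFinite.Build {vspace V}
  (pcan_enumP (can_pcan vspace_setK)).

End FiniteSubspaces.

Definition two_graph (T : finType) (P : {set T}) (D : {set {set T}}) : Prop :=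
  (forall S, S \in D -> S \subset P /\ #|S| = 3) /\
  (forall Q : {set T}, Q \subset P -> #|Q| = 4 ->
     ~~ odd #|[set S in D | S \subset Q]|).

Section QuadraticCharacter.

Variable F : finFieldType.

Definition quad_char (a : F) : int :=
  if a == 0 then 0 else if [exists b : F, a == b ^+ 2] then 1 else -1.

End QuadraticCharacter.

Section Symplectic.

Variables (F : finFieldType) (vT : vectType F).
Local Notation V := (finvect_type vT).

Definition alternating (B : V -> V -> F) : Prop := forall x, B x x = 0.

Definition nondegenerate_form (B : V -> V -> F) : Prop :=
  forall x, (forall y, B x y = 0) -> x = 0.

Definition totally_isotropic (B : V -> V -> F) (X : {vspace V}) : bool :=
  [forall x in X, forall y in X, B x y == 0].

Definition lagrangians (n : nat) (B : V -> V -> F) : {set {vspace V}} :=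
  [set X | (\dim X == n) && totally_isotropic B X].

(* Only the values of [f] on tuples of vectors of X matter.                   *)
Definition determinant_function (n : nat) (X : {vspace V})
    (f : n.-tuple V -> F) : Prop :=
  let upd (x : n.-tuple V) i u := [tuple if j == i then u else tnth x j | j < n]
  in
  [/\ forall (x : n.-tuple V) i a u v,
        {subset x <= X} -> u \in X -> v \in X ->
        f (upd x i (a *: u + v)) = a * f (upd x i u) + f (upd x i v),
      forall (x : n.-tuple V) i j,
        {subset x <= X} -> i != j -> tnth x i = tnth x j -> f x = 0
    & exists2 x : n.-tuple V, {subset x <= X} & f x != 0].

Section Sigma.

Variables (n : nat) (B : V -> V -> F).
Variable delta : {vspace V} -> n.-tuple V -> F.

Definition dist (X Y : {vspace V}) : nat := (n - \dim (X :&: Y))%N.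

Definition adapted_bases (X Y : {vspace V}) (x y : n.-tuple V) : bool :=
  [&& basis_of X x, basis_of Y y,
      drop (dist X Y) x == drop (dist X Y) y
    & basis_of (X :&: Y) (drop (dist X Y) x)].

Definition sigma_bases (X Y : {vspace V}) (x y : n.-tuple V) : int :=
  quad_char (delta X x * delta Y y *
    \det (\matrix_(i < dist X Y, j < dist X Y) B x`_i y`_j)).

(* On [lagrangians n B] adapted bases always exist, so the default value is   *)
(* never used there.                                                          *)
Definition sigma (X Y : {vspace V}) : int :=
  if [pick xy : n.-tuple V * n.-tuple V | adapted_bases X Y xy.1 xy.2]
  is Some xy then sigma_bases X Y xy.1 xy.2 else 0.

Definition coherent (X Y Z : {vspace V}) : bool :=
  sigma X Y * sigma Y Z * sigma Z X == 1.

Definition coherent_triples : {set {set {vspace V}}} :=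
  [set S | [exists X in lagrangians n B, exists Y in lagrangians n B,
     exists Z in lagrangians n B,
     [&& uniq [:: X; Y; Z], coherent X Y Z & S == [set X; Y; Z]]]].

End Sigma.

Section SemiIsometries.

Variable B : V -> V -> F.

Definition field_automorphism (tau : {perm F}) : bool :=
  [&& tau 1 == 1,
      [forall a, forall b, tau (a + b) == tau a + tau b]
    & [forall a, forall b, tau (a * b) == tau a * tau b]].

Definition semilinear_perm (tau : {perm F}) (g : {perm V}) : bool :=
  [forall x, forall y, g (x + y) == g x + g y] &&
  [forall a, forall x, g (a *: x) == tau a *: g x].

Definition semi_isometry (tau : {perm F}) (g : {perm V}) : bool :=
  [&& field_automorphism tau, semilinear_perm tau g
    & [forall x, forall y, B (g x) (g y) == tau (B x y)]].

Definition SigmaSp : {set {perm V}} :=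
  [set g | [exists tau, semi_isometry tau g]].

Lemma SigmaSpP (g : {perm V}) :
  reflect (exists tau : {perm F},
            [/\ field_automorphism tau,
                (forall x y, g (x + y) = g x + g y),
                (forall a x, g (a *: x) = tau a *: g x)
              & forall x y, B (g x) (g y) = tau (B x y)])
          (g \in SigmaSp).
Proof.
rewrite inE; apply: (iffP existsP) => -[tau].
  case/and3P=> aut /andP[/'forall_forallP gD /'forall_forallP gZ].
  move=> /'forall_forallP gB; exists tau.
  by split=> // *; apply/eqP; [apply: gD | apply: gZ | apply: gB].
case=> aut gD gZ gB; exists tau; rewrite /semi_isometry /semilinear_perm aut /=.
by apply/andP; split; [apply/andP; split|]; apply/'forall_forallP => *; apply/eqP.
Qed.

Lemma SigmaSp_group_set : group_set SigmaSp.
Proof.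
apply/group_setP; split.
  apply/SigmaSpP; exists 1%g; split=> *; rewrite ?perm1 //.
  apply/and3P; split; rewrite ?perm1 //;
  by apply/'forall_forallP=> a b; rewrite !perm1.
move=> g h /SigmaSpP[s [/and3P[s1 sD sM] gD gZ gB]].
move=> /SigmaSpP[t [/and3P[t1 tD tM] hD hZ hB]].
apply/SigmaSpP; exists (s * t)%g.
split=> [|x y|a x|x y]; rewrite ?permM ?gD ?gZ ?hB ?gB //.
apply/and3P; split; first by rewrite permM (eqP s1).
  apply/'forall_forallP=> a b; rewrite !permM.
  by rewrite (eqP ('forall_forallP sD a b)) ('forall_forallP tD _ _).
apply/'forall_forallP=> a b; rewrite !permM.
by rewrite (eqP ('forall_forallP sM a b)) ('forall_forallP tM _ _).
Qed.

Canonical SigmaSp_group := Group SigmaSp_group_set.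

(* For g in [SigmaSp] the set g(X) is already a subspace: [mem_vspace_im].    *)
(* Elsewhere the value is irrelevant, but an action on the domain [SigmaSp]   *)
(* must be injective for every permutation.                                   *)
Definition vspace_im (X : {vspace V}) (g : {perm V}) : {vspace V} :=
  if g \in SigmaSp then <<[seq g x | x : V in X]>>%VS else X.

Lemma mem_vspace_im (X : {vspace V}) (g : {perm V}) (y : V) :
  g \in SigmaSp -> (y \in vspace_im X g) = (g^-1%g y \in X).
Proof.
move=> Gg; rewrite /vspace_im Gg; case/SigmaSpP: Gg => tau [_ gD gZ _].
have g0 : g 0 = 0 by apply: (addIr (g 0)); rewrite -gD !add0r.
apply/idP/idP=> [|Xy]; last first.
  by rewrite -[y](permKV g); apply/memv_span/image_f.
rewrite -[[seq g x | x : V in X]]in_tupleE.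
set s := in_tuple _ => /coord_span ->.
have sumX I (r : seq I) (G : I -> V) :
    (forall i, g^-1%g (G i) \in X) -> g^-1%g (\sum_(i <- r) G i) \in X.
  move=> XG; elim: r => [|i r IH].
    by rewrite big_nil -g0 permK mem0v.
  rewrite big_cons -[G i](permKV g) -[\sum_(j <- r) _](permKV g) -gD permK.
  exact: memvD.
apply: sumX => i.
have /imageP[x Xx ->] : s`_i \in [seq g x | x : V in X] by rewrite mem_nth.
by rewrite -[coord _ _ _](permKV tau) -gZ permK memvZ.
Qed.

Lemma vspace_im_is_action : is_action SigmaSp vspace_im.
Proof.
split=> [g X Y eqXY|X g h Gg Gh]; last first.
  by apply/vspaceP=> y; rewrite !mem_vspace_im ?groupM // invMg permM.
have [Gg|nGg] := boolP (g \in SigmaSp); last first.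
  by move: eqXY; rewrite /vspace_im (negPf nGg).
apply/vspaceP=> y; rewrite -[y](permK g).
by rewrite -!(mem_vspace_im _ _ Gg) eqXY.
Qed.

Canonical vspace_action := Action vspace_im_is_action.

Definition minus_id : {perm V} := perm (@oppr_inj V).

Definition PSigmaSp := (SigmaSp / <[minus_id]>)%g.

End SemiIsometries.
End Symplectic.

(* Main.v *)
Require Import Defs.
From HB Require Import structures.
From mathcomp Require Import all_boot all_order all_algebra all_fingroup.
From mathcomp Require Import all_solvable all_field ring.

(* A symmetric sign function on pairs makes the triples of positive product a *)
(* two-graph: in the product of the four triple signs of a 4-set every pair   *)
(* occurs twice.  Here sigma is such a function: changing adapted bases       *)
(* multiplies the argument of the quadratic character by a nonzero square, it *)
(* never vanishes because Lagrangians are their own orthogonals, and          *)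
(* exchanging X and Y costs chi(-1)^k = 1.  A semi-isometry g multiplies      *)
(* sigma(X, Y) by e(X) e(Y), where e(X) = 1 or -1 measures the effect of g on *)
(* the determinant functions, and these signs cancel over a triple.           *)

(** The signs [sigma] form a symmetric signing of the pairs of Lagrangians, and such a signing
    always yields a two-graph ([two_graph_positive_triples]). Three facts make it one. Passing
    between adapted bases changes the argument of the character by a square ([det_gram_change]),
    because determinant functions transform by the determinant of the base change
    ([alternating_mx_det]). That argument is nonzero ([det_gram_neq0]), because a vector orthogonal
    to a Lagrangian lies in it ([lagrangian_ortho]). Interchanging X and Y transposes and negates
    the Gram matrix, which is harmless because -1 is a square ([quad_charN1], [sigmaC]).

    A semi-isometry carries adapted bases to adapted bases and applies a field automorphism to the
    Gram matrix, which the character does not see. What remains is one sign per Lagrangian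
    ([sigma_im]): [sigma] is switched, and triple products are invariant under switching. Since -I
    fixes every subspace, this descends to the quotient group. *)

Set Implicit Arguments.
Unset Strict Implicit.
Unset Printing Implicit Defensive.

Import GRing.Theory.
Local Open Scope ring_scope.

(** * Alternating multilinear functions of the rows of a matrix *)

Section AlternatingForms.

Variable F : fieldType.

Definition set_row m n (A : 'M[F]_(m, n)) (i : 'I_m) (u : 'rV[F]_n) :=
  \matrix_(j, l) (if j == i then u 0 l else A j l).

Lemma set_row_id m n (A : 'M[F]_(m, n)) i : set_row A i (row i A) = A.
Proof. by apply/matrixP=> j l; rewrite !mxE; case: eqP => // ->. Qed.

Definition multilinear_mx m n (G : 'M[F]_(m, n) -> F) :=
  forall A i a u v,
    G (set_row A i (a *: u + v)) = a * G (set_row A i u) + G (set_row A i v).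

Definition alternating_mx m n (G : 'M[F]_(m, n) -> F) :=
  forall A i j, i != j -> row i A = row j A -> G A = 0.

Lemma det_multilinear_mx n : multilinear_mx (@determinant F n).
Proof.
move=> A i a u v; rewrite -[\det (set_row A i v)]mul1r.
by apply: (determinant_multilinear (i0 := i)); apply/matrixP=> j l;
  rewrite !mxE ?eqxx ?mul1r // eq_sym (negPf (neq_lift _ _)).
Qed.

Section Uniqueness.

Variables (m n : nat) (G : 'M[F]_(m, n) -> F).
Hypotheses (Glin : multilinear_mx G) (Galt : alternating_mx G).

Lemma multilinear_mxD A i u v :
  G (set_row A i (u + v)) = G (set_row A i u) + G (set_row A i v).
Proof. by rewrite -[u in LHS]scale1r Glin mul1r. Qed.

Lemma multilinear_mx0 A i : G (set_row A i 0) = 0.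
Proof. by apply: (addIr (G (set_row A i 0))); rewrite -multilinear_mxD !add0r. Qed.

Lemma multilinear_mx_sum A i I (r : seq I) (c : I -> F) u :
  G (set_row A i (\sum_(k <- r) c k *: u k)) =
  \sum_(k <- r) c k * G (set_row A i (u k)).
Proof.
elim: r => [|k r IHr]; first by rewrite !big_nil multilinear_mx0.
by rewrite !big_cons Glin IHr.
Qed.

(** Polarisation: the function vanishes when the sum of rows i and j is put in both places, and
    expanding bilinearly leaves only the two mixed terms. *)
Lemma alternating_mx_xrow A i j : i != j -> G (xrow i j A) = - G A.
Proof.
move=> ij; have ji : j != i by rewrite eq_sym.
pose W u v := G (set_row (set_row A i u) j v).
have Wsym u v : W u v = G (set_row (set_row A j v) i u).
  congr G; apply/matrixP=> k l; rewrite !mxE.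
  by case: eqP => // ->; rewrite (negPf ji).
have WDl u u' v : W (u + u') v = W u v + W u' v.
  by rewrite !Wsym multilinear_mxD.
have WDr u v v' : W u (v + v') = W u v + W u v'.
  by rewrite /W multilinear_mxD.
have W0 u : W u u = 0.
  apply: (Galt ij); apply/rowP=> l.
  by rewrite !mxE eqxx (negPf ij) eqxx.
have <- : W (row i A) (row j A) = G A.
  by rewrite /W !set_row_id.
have <- : W (row j A) (row i A) = G (xrow i j A).
  congr G; apply/matrixP=> k l; rewrite !mxE.
  have [->|kj] := eqVneq k j; first by rewrite tpermR.
  have [->|ki] := eqVneq k i; first by rewrite tpermL.
  by rewrite tpermD // eq_sym.
have := W0 (row i A + row j A).
rewrite WDl !WDr !W0 add0r addr0 => /eqP; rewrite addr_eq0 => /eqP ->.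
by rewrite opprK.
Qed.

End Uniqueness.

(** Induction on the number k of leading rows not known to be standard basis vectors: row k - 1 is
    expanded by linearity. When all rows are standard, either two coincide, or the matrix is a
    permutation matrix and transpositions lead back to the identity. *)
Lemma alternating_mx_eq0 n (G : 'M[F]_n -> F) :
  multilinear_mx G -> alternating_mx G -> G 1%:M = 0 -> forall A, G A = 0.
Proof.
move=> Glin Galt G1.
have Gperm (s : 'S_n) : G (perm_mx s) = 0.
  have [ts -> /=] := prod_tpermP s.
  elim: ts => [|t ts IHts]; first by rewrite big_nil perm_mx1.
  case/andP=> dt /IHts IH; rewrite big_cons perm_mxM.
  by rewrite -xrowE alternating_mx_xrow // IH oppr0.
suff Gunit k : forall A : 'M[F]_n,
    (forall i : 'I_n, (k <= i)%N -> exists j, row i A = delta_mx 0 j) -> G A = 0.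
  by move=> A; apply: (Gunit n) => i; rewrite leqNgt ltn_ord.
elim: k => [A rowA|k IHk A rowA].
  have phiP i : {j | row i A == delta_mx 0 j}.
    by apply: sigW; have [//|j ->] := rowA i; exists j.
  pose phi i := sval (phiP i).
  have rowphi i : row i A = delta_mx 0 (phi i).
    by apply/eqP; exact: (svalP (phiP i)).
  have [/injectiveP phi_inj|/injectivePn[i [j ij eqphi]]] :=
    boolP (injectiveb phi).
    suff -> : A = perm_mx (perm phi_inj) by [].
    apply/row_matrixP=> i; rewrite rowphi; apply/rowP=> l.
    by rewrite !mxE permE eqxx eq_sym.
  by apply: (Galt _ _ _ ij); rewrite !rowphi eqphi.
have [nk|kn] := leqP n k.
  by apply: IHk => i; rewrite leqNgt (leq_trans (ltn_ord i) nk).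
rewrite -[A](set_row_id _ (Ordinal kn)) (row_sum_delta (row _ A)).
rewrite multilinear_mx_sum // big1 // => j _; rewrite IHk ?mulr0 // => i ki.
have [->|ik] := eqVneq i (Ordinal kn).
  by exists j; apply/rowP=> l; rewrite !mxE eqxx.
have [|l rowl] := rowA i.
  by rewrite ltn_neqAle ki andbT; apply: contraNneq ik => kE; apply/eqP/val_inj.
by exists l; rewrite -rowl; apply/rowP=> l'; rewrite !mxE (negPf ik).
Qed.

Lemma alternating_mx_det n (G : 'M[F]_n -> F) :
  multilinear_mx G -> alternating_mx G -> forall A, G A = \det A * G 1%:M.
Proof.
move=> Glin Galt A; apply/eqP; rewrite -subr_eq0; apply/eqP.
apply: (alternating_mx_eq0 (G := fun A => G A - \det A * G 1%:M)) => /=.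
- by move=> M i a u v; rewrite Glin det_multilinear_mx; ring.
- move=> M i j ij rowM; rewrite (Galt _ _ _ ij rowM) (determinant_alternate ij).
    by rewrite mul0r subr0.
  by move=> l; move/rowP/(_ l): rowM; rewrite !mxE.
by rewrite det1 mul1r subrr.
Qed.

End AlternatingForms.

(** * The quadratic character *)

Section QuadChar.

Variable F : finFieldType.
Implicit Types a b : F.

Lemma quad_char_unit a : a != 0 -> (quad_char a == 1) || (quad_char a == -1).
Proof. by move=> /negPf a0; rewrite /quad_char a0; case: ifP. Qed.

Lemma quad_char_sqr a : a != 0 -> quad_char (a ^+ 2) = 1.
Proof.
move=> a0; rewrite /quad_char sqrf_eq0 (negPf a0).
by case: existsP => // -[]; exists a.
Qed.

Lemma quad_charMsq a c : c != 0 -> quad_char (c ^+ 2 * a) = quad_char a.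
Proof.
move=> c0; rewrite /quad_char mulf_eq0 sqrf_eq0 (negPf c0) /=.
case: eqP => // _; congr (if _ then _ else _); apply/existsP/existsP => -[b /eqP ab].
  by exists (b / c); rewrite expr_div_n -ab [c ^+ 2 * a]mulrC mulfK // sqrf_eq0.
by exists (c * b); rewrite exprMn ab.
Qed.

(** An endomorphism of a finite field is bijective, so it reflects squares as well as preserving
    them. *)
Lemma quad_char_rmorph (tau : {rmorphism F -> F}) a :
  quad_char (tau a) = quad_char a.
Proof.
have [tau' tauK tau'K] : bijective tau by apply/injF_bij/fmorph_inj.
rewrite /quad_char fmorph_eq0; case: eqP => // _; congr (if _ then _ else _).
apply/existsP/existsP => -[b /eqP ab].
  exists (tau' b); apply/eqP/(fmorph_inj tau).
  by rewrite rmorphXn /= tau'K.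
by exists (tau b); rewrite ab rmorphXn.
Qed.

Hypothesis oddF : odd #|F|.

(** The unit group is cyclic of even order, so the parity of an exponent of a generator is well
    defined, and it decides squareness. Multiplicativity of the character follows at once. *)
Lemma quad_char_gen :
  exists g : {unit F},
    [/\ forall a, a != 0 -> exists i, a = val g ^+ i,
        #[g]%g = #|F|.-1 & forall i, quad_char (val g ^+ i) = (-1) ^+ i].
Proof.
have cardU : #|[set: {unit F}]| = #|F|.-1 by rewrite card_finField_unit.
have /cyclicP[g defU] := field_unit_group_cyclic [set: {unit F}]%G.
have og : #[g]%g = #|F|.-1 by rewrite -cardU defU.
exists g; split=> // [a a0|i].
  have ua : a \is a GRing.unit by rewrite unitfE.
  have : FinRing.unit F ua \in <[g]>%g by rewrite -defU inE.
  by case/cycleP=> i /(congr1 val) /= ->; exists i; rewrite FinRing.val_unitX.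
have g0 : val g != 0 by rewrite -unitfE (valP g).
have ev_og : ~~ odd #[g]%g.
  by rewrite og; move: oddF; case: #|F|.
rewrite /quad_char expf_eq0 (negPf g0) andbF -signr_odd.
case: existsP => [[b /eqP gb]|].
  have b0 : b != 0.
    by rewrite -sqrf_eq0 -gb expf_eq0 (negPf g0) andbF.
  have ub : b \is a GRing.unit by rewrite unitfE.
  have : FinRing.unit F ub \in <[g]>%g by rewrite -defU inE.
  case/cycleP=> j /(congr1 val); rewrite /= FinRing.val_unitX => bE.
  have /eqP : (g ^+ i = g ^+ (j * 2))%g.
    by apply: val_inj; rewrite !FinRing.val_unitX gb bE exprM.
  rewrite eq_expg_mod_order => /eqP mod_ij.
  have : odd i = odd (j * 2).
    rewrite (divn_eq i #[g]%g) (divn_eq (j * 2) #[g]%g) mod_ij !oddD.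
    by rewrite !(oddM _ #[g]%g) (negPf ev_og) !andbF.
  by rewrite oddM andbF => ->.
case: (boolP (odd i)) => [//|evi]; case.
by exists (val g ^+ i./2); rewrite -exprM muln2 even_halfK.
Qed.

Lemma quad_charM a b : quad_char (a * b) = quad_char a * quad_char b.
Proof.
have [->|a0] := eqVneq a 0; first by rewrite mul0r /quad_char eqxx mul0r.
have [->|b0] := eqVneq b 0; first by rewrite mulr0 /quad_char eqxx mulr0.
have [g [gen _ chig]] := quad_char_gen.
have [i ->] := gen _ a0; have [j ->] := gen _ b0.
by rewrite -exprD !chig exprD.
Qed.

Lemma quad_charN1 : #|F| = 1 %[mod 4] -> quad_char (-1 : F) = 1.
Proof.
move=> F4; have [g [_ og _]] := quad_char_gen.
have F1 : (1 < #|F|)%N := finNzRing_gt1 F.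
have /dvdnP[m mE] : (4 %| #|F|.-1)%N.
  by rewrite -subn1 -eqn_mod_dvd ?F4 // ltnW.
have m0 : (0 < m)%N by case: m mE => // /eqP; rewrite -subn1 subn_eq0 leqNgt F1.
(* With m = (q - 1) / 4, h has order 4, so its square is -1. *)
pose h : F := val g ^+ m.
have h4 : (h ^+ 2) ^+ 2 == 1.
  rewrite /h -!exprM.
  have -> : (m * (2 * 2) = #[g]%g)%N by rewrite og mE.
  by rewrite -FinRing.val_unitX expg_order.
have h2 : h ^+ 2 != 1.
  rewrite /h -exprM -FinRing.val_unitX -[1]/(val (1%g : {unit F})) (inj_eq val_inj).
  rewrite -order_dvdn og mE; apply: contraL (leqnn (m * 2)) => dv.
  have := dvdn_leq _ dv; rewrite muln_gt0 m0 => /(_ isT).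
  by rewrite leq_pmul2l.
move: h4; rewrite -subr_eq0 -[X in _ - X](expr1n _ 2) subr_sqr mulf_eq0.
rewrite subr_eq0 (negPf h2) addr_eq0 => /eqP <-.
by apply: quad_char_sqr; rewrite /h expf_eq0 -[_ == 0]negbK -unitfE (valP g) andbF.
Qed.

End QuadChar.

(** * The two-graph of a symmetric signing *)

Section TwoGraphOfSigning.

Variables (T : finType) (P : {set T}) (s : T -> T -> int).
Hypothesis s_sym : {in P &, forall x y, s x y = s y x}.
Hypothesis s_sign : {in P &, forall x y, x != y -> (s x y == 1) || (s x y == -1)}.

Lemma cards3 (x y z : T) : uniq [:: x; y; z] -> #|[set x; y; z]| = 3.
Proof.
move=> uxyz; have <- : #|[:: x; y; z]| = 3 by rewrite (card_uniqP uxyz).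
by apply: eq_card => t; rewrite !inE -!orbA.
Qed.

(** Shaped like [coherent_triples], which is then an instance by mere conversion. *)
Definition positive_triples : {set {set T}} :=
  [set S | [exists x in P, exists y in P, exists z in P,
     [&& uniq [:: x; y; z], s x y * s y z * s z x == 1 & S == [set x; y; z]]]].

Lemma positive_triplesP S :
  reflect (exists x y z, [/\ [/\ x \in P, y \in P & z \in P], uniq [:: x; y; z],
             s x y * s y z * s z x = 1 & S = [set x; y; z]])
          (S \in positive_triples).
Proof.
rewrite inE; apply: (iffP idP).
  case/exists_inP=> x Px /exists_inP[y Py /exists_inP[z Pz]].
  by case/and3P=> uxyz /eqP sxyz /eqP ->; exists x, y, z.
case=> x [y [z [[Px Py Pz] uxyz sxyz ->]]].
apply/exists_inP; exists x => //; apply/exists_inP; exists y => //.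
by apply/exists_inP; exists z; rewrite // uxyz sxyz !eqxx.
Qed.

(** Membership provides some ordering of the three points; by symmetry of [s] all six orderings have
    the same product. *)
Lemma mem_positive_triples x y z :
  x \in P -> y \in P -> z \in P -> uniq [:: x; y; z] ->
  ([set x; y; z] \in positive_triples) = (s x y * s y z * s z x == 1).
Proof.
move=> Px Py Pz uxyz; apply/positive_triplesP/eqP => [|sxyz]; last first.
  by exists x, y, z.
case=> a [b [c [_ uabc sabc eq_abc]]].
have : [&& a \in [set x; y; z], b \in [set x; y; z] & c \in [set x; y; z]].
  by rewrite eq_abc !inE !eqxx !orbT.
case/and3P; rewrite !inE -!orbA => abc1 abc2 abc3.
have yx := s_sym Px Py; have zy := s_sym Py Pz.
have xz := s_sym Pz Px.
rewrite -sabc; move: uabc.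
case/or3P: abc1 => /eqP->; case/or3P: abc2 => /eqP->;
  case/or3P: abc3 => /eqP->; rewrite /= !inE ?eqxx ?orbT ?andbF //= => _.
all: rewrite ?yx ?zy ?xz; ring.
Qed.

Lemma two_graph_positive_triples : two_graph P positive_triples.
Proof.
split=> [S /positive_triplesP[x [y [z [[Px Py Pz] uxyz _ ->]]]]|Q sQP Q4].
  split; first by apply/subsetP=> t; rewrite !inE -orbA => /or3P[]/eqP->.
  exact: cards3.
(* A 3-subset of Q is Q minus one point, so the triples are counted by their missing points. *)
have -> : [set S in positive_triples | S \subset Q] =
          [set Q :\ t | t in [set t in Q | Q :\ t \in positive_triples]].
  apply/setP=> S; apply/idP/imsetP => [|[t]]; last first.
    by rewrite !inE => /andP[_ DQt] ->; rewrite DQt subD1set.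
  rewrite inE => /andP[DS sSQ].
  have S3 : #|S| = 3.
    case/positive_triplesP: DS => x [y [z [_ uxyz _ ->]]].
    exact: cards3.
  have /cards1P[t QS] : #|Q :\: S| == 1%N.
    by rewrite cardsD (setIidPr sSQ) Q4 S3.
  have ES : S = Q :\ t by rewrite -QS setDDr setDv set0U (setIidPr sSQ).
  exists t => //; rewrite in_set -ES DS andbT.
  by have := set11 t; rewrite -QS inE => /andP[].
rewrite card_in_imset => [|t u]; last first.
  rewrite !inE => /andP[Qt _] /andP[Qu _] eqQ.
  apply/eqP; apply: contraT => tu.
  by have := setD11 t Q; rewrite eqQ !inE tu Qt.
pose p t := Q :\ t \in positive_triples.
have -> : #|[set t in Q | p t]| = size (filter p (enum Q)).
  have /card_uniqP <- := filter_uniq p (enum_uniq Q).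
  by apply: eq_card => t; rewrite !inE mem_filter mem_enum andbC.
move: (enum_uniq Q) (mem_enum Q); rewrite cardE in Q4.
case: (enum Q) Q4 => [|a [|b [|c [|d []]]]] //= _ uQ memQ.
have [Pa Pb Pc Pd] : [/\ a \in P, b \in P, c \in P & d \in P].
  by split; apply: (subsetP sQP); rewrite -memQ !inE eqxx ?orbT.
move: uQ; rewrite !inE !negb_or -!andbA.
case/and5P=> ab ac ad bc /and3P[bd cd _].
have QE t : Q :\ t = [set x in [:: a; b; c; d] | x != t].
  by apply/setP=> x; rewrite !inE -memQ !inE andbC.
have pa : p a = (s b c * s c d * s d b == 1).
  rewrite /p -mem_positive_triples //; last by rewrite /= !inE !negb_or bc bd cd.
  congr (in_mem _ _); rewrite QE; apply/setP=> x; rewrite !inE -!orbA.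
  by case: (eqVneq x a) => [->|]; rewrite ?(negPf ab, negPf ac, negPf ad) ?andbT.
have pb : p b = (s a c * s c d * s d a == 1).
  rewrite /p -mem_positive_triples //; last by rewrite /= !inE !negb_or ac ad cd.
  congr (in_mem _ _); rewrite QE; apply/setP=> x; rewrite !inE -!orbA.
  case: (eqVneq x b) => [->|]; rewrite ?(negPf bc, negPf bd) ?andbT //=.
  by rewrite [b == a]eq_sym (negPf ab).
have pc : p c = (s a b * s b d * s d a == 1).
  rewrite /p -mem_positive_triples //; last by rewrite /= !inE !negb_or ab ad bd.
  congr (in_mem _ _); rewrite QE; apply/setP=> x; rewrite !inE -!orbA.
  case: (eqVneq x c) => [->|]; rewrite ?(negPf cd) ?andbT //=.
  by rewrite [c == a]eq_sym (negPf ac) [c == b]eq_sym (negPf bc).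
have pd : p d = (s a b * s b c * s c a == 1).
  rewrite /p -mem_positive_triples //; last by rewrite /= !inE !negb_or ab ac bc.
  congr (in_mem _ _); rewrite QE; apply/setP=> x; rewrite !inE -!orbA.
  case: (eqVneq x d) => [->|]; rewrite ?andbT ?orbF //=.
  by rewrite ![d == _]eq_sym (negPf ad) (negPf bd) (negPf cd).
rewrite pa pb pc pd (s_sym Pd Pb) (s_sym Pd Pa) (s_sym Pc Pa).
(* Each pair lies in two of the four triples, so the four products multiply to 1 and an even number
   of them are positive; this is checked on all 64 assignments of signs. *)
case/orP: (s_sign Pa Pb ab) => /eqP ->; case/orP: (s_sign Pa Pc ac) => /eqP ->;
case/orP: (s_sign Pa Pd ad) => /eqP ->; case/orP: (s_sign Pb Pc bc) => /eqP ->;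
case/orP: (s_sign Pb Pd bd) => /eqP ->; by case/orP: (s_sign Pc Pd cd) => /eqP ->.
Qed.

End TwoGraphOfSigning.

(** * Coordinates in bases with a common tail *)

Section CoordinateMatrix.

Variables (K : fieldType) (vT : vectType K).

Definition coord_mx m n (x : n.-tuple vT) (y : m.-tuple vT) : 'M[K]_(m, n) :=
  \matrix_(i, j) coord x j y`_i.

Lemma coord_drop n (x : n.-tuple vT) k v (i : 'I_n) :
  free x -> v \in <<drop k x>>%VS -> (i < k)%N -> coord x i v = 0.
Proof.
move=> fx xv ik.
suff /subvP/(_ v xv): (<<drop k x>> <= lker (linfun (coord x i : vT -> K^o)))%VS.
  by rewrite memv_ker lfunE => /eqP.
apply/span_subvP => u /(nthP 0)[l]; rewrite size_drop size_tuple ltn_subRL => ln.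
rewrite nth_drop => <-; rewrite memv_ker lfunE /=.
rewrite (coord_free (Ordinal ln)) // -val_eqE /= gtn_eqF //.
exact: leq_trans ik (leq_addr _ _).
Qed.

(** This is why the base changes in X and in Y share a diagonal block. *)
Lemma eq_coord_drop n (x y : n.-tuple vT) k v (i : 'I_n) :
  free x -> free y -> drop k x = drop k y -> v \in <<drop k x>>%VS ->
  coord x i v = coord y i v.
Proof.
move=> fx fy xy xv; apply/eqP; rewrite -subr_eq0.
pose f := linfun (coord x i : vT -> K^o) - linfun (coord y i : vT -> K^o).
suff /subvP/(_ v xv): (<<drop k x>> <= lker f)%VS.
  by rewrite memv_ker !lfunE /= opp_lfunE !lfunE.
apply/span_subvP => u /(nthP 0)[l]; rewrite size_drop size_tuple ltn_subRL => ln.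
move=> uE; rewrite memv_ker lfunE /= opp_lfunE !lfunE /= -{1}uE.
move: uE; rewrite {1}xy !nth_drop => <-.
by rewrite !(coord_free (Ordinal ln)) // subrr.
Qed.

End CoordinateMatrix.

(** * Determinant functions on a subspace *)

Section DeterminantFunction.

Variables (F : finFieldType) (vT : vectType F).
Local Notation V := (finvect_type vT).
Variables (n : nat) (X : {vspace V}) (f : n.-tuple V -> F).
Hypothesis detf : determinant_function X f.

(** With x fixed, the left side is a multilinear alternating function of the rows of A, so
    [alternating_mx_det] applies. *)
Lemma determinant_function_comb (x : n.-tuple V) (A : 'M_n) :
  {subset x <= X} ->
  f [tuple \sum_j A i j *: x`_j | i < n] = \det A * f x.
Proof.
case: detf => flin falt _ Xx.
have xX (j : 'I_n) : x`_j \in X by apply: Xx; rewrite mem_nth ?size_tuple.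
have combX (M : 'M[F]_n) : {subset [tuple \sum_j M i j *: x`_j | i < n] <= X}.
  move=> u /mapP[i _ ->]; apply: memv_suml => j _; exact: memvZ.
pose G (M : 'M[F]_n) := f [tuple \sum_j M i j *: x`_j | i < n].
have -> : f x = G 1%:M.
  congr f; apply: eq_from_tnth => i; rewrite tnth_mktuple (bigD1 i) //= mxE eqxx.
  rewrite scale1r big1 ?addr0 -?tnth_nth // => j ji.
  by rewrite mxE eq_sym (negPf ji) scale0r.
apply: (alternating_mx_det (G := G)) => [M i a u v|M i j ij eqM].
  have setE w : [tuple \sum_j set_row M i w k j *: x`_j | k < n] =
     [tuple if k == i then \sum_j w 0 j *: x`_j
            else tnth [tuple \sum_j M k j *: x`_j | k < n] k | k < n].
    apply: eq_from_tnth => k; rewrite !tnth_mktuple.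
    by case: eqP => [->|/eqP/negPf ki]; apply: eq_bigr => j _; rewrite mxE ?eqxx ?ki.
  have wX (w : 'rV[F]_n) : \sum_j w 0 j *: x`_j \in X.
    by apply: memv_suml => j _; exact: memvZ.
  rewrite /G !setE -flin //; congr f.
  apply: eq_from_tnth => k; rewrite !tnth_mktuple; case: ifP => // _.
  rewrite scaler_sumr -big_split; apply: eq_bigr => j _ /=.
  by rewrite !mxE scalerDl scalerA.
apply: (falt _ i j) => //; rewrite !tnth_mktuple; apply: eq_bigr => l _.
by move/rowP/(_ l): eqM; rewrite !mxE => ->.
Qed.

Lemma determinant_function_basis (x x' : n.-tuple V) :
  basis_of X x -> {subset x' <= X} -> f x' = \det (coord_mx x x') * f x.
Proof.
move=> bx Xx'; rewrite -determinant_function_comb; last by move=> u; exact: basis_mem.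
congr f; apply: eq_from_tnth => i; rewrite tnth_mktuple (tnth_nth 0).
rewrite {1}(coord_basis bx (v := x'`_i)); last by rewrite Xx' ?mem_nth ?size_tuple.
by apply: eq_bigr => j _; rewrite mxE.
Qed.

Lemma determinant_function_neq0 (x : n.-tuple V) : basis_of X x -> f x != 0.
Proof.
move=> bx; case: detf => _ _ [x' Xx']; rewrite (determinant_function_basis bx) //.
by rewrite mulf_eq0 negb_or => /andP[].
Qed.

End DeterminantFunction.

(** * Independence of the adapted bases, and symmetry of [sigma] *)

Section SigmaBases.

Variables (F : finFieldType) (vT : vectType F).
Local Notation V := (finvect_type vT).
Variables (B : {biscalar V}).
Implicit Types X Y : {vspace V}.

Definition gram k n (x y : n.-tuple V) : 'M[F]_k := \matrix_(i, j) B x`_i y`_j.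

Lemma totally_isotropicP X :
  reflect {in X &, forall u v, B u v = 0} (totally_isotropic B X).
Proof.
apply: (iffP forall_inP) => [H u v Xu Xv|H u Xu].
  by apply/eqP/(forall_inP (H u Xu)).
by apply/forall_inP => v Xv; rewrite H.
Qed.

(* The base changes from [x] to [x'] and from [y] to [y'] are block           *)
(* triangular with a common diagonal block, coming from X :&: Y; its          *)
(* determinant therefore enters squared.                                      *)
Lemma det_gram_change k m X Y f g (x y x' y' : (k + m).-tuple V) :
  totally_isotropic B X -> totally_isotropic B Y ->
  determinant_function X f -> determinant_function Y g ->
  basis_of X x -> basis_of Y y -> drop k x = drop k y ->
  basis_of (X :&: Y) (drop k x) ->
  basis_of X x' -> basis_of Y y' -> drop k x' = drop k y' ->
  basis_of (X :&: Y) (drop k x') ->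
  exists2 c, c != 0 &
    f x' * g y' * \det (gram k x' y') = c ^+ 2 * (f x * g y * \det (gram k x y)).
Proof.
move=> /totally_isotropicP isoX /totally_isotropicP isoY df dg bx by_ xy bxy bx' by' xy' bxy'.
set P := coord_mx x x'; set Q := coord_mx y y'.
have [fx fy] := (basis_free bx, basis_free by_).
have mem_x (i : 'I_(k + m)) : x`_i \in X.
  by rewrite (basis_mem bx) // mem_nth ?size_tuple.
have mem_y (i : 'I_(k + m)) : y`_i \in Y.
  by rewrite (basis_mem by_) // mem_nth ?size_tuple.
have mem_x' (i : 'I_(k + m)) : x'`_i \in X.
  by rewrite (basis_mem bx') // mem_nth ?size_tuple.
have mem_y' (i : 'I_(k + m)) : y'`_i \in Y.
  by rewrite (basis_mem by') // mem_nth ?size_tuple.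
have nth_tail (z : (k + m).-tuple V) (i : 'I_m) : z`_(rshift k i) = (drop k z)`_i.
  by rewrite nth_drop.
have mem_tail z (i : 'I_m) : basis_of (X :&: Y) (drop k (z : (k + m).-tuple V)) ->
    z`_(rshift k i) \in (X :&: Y)%VS.
  move=> bz; rewrite nth_tail (basis_mem bz) // mem_nth //.
  by rewrite size_drop size_tuple addKn.
have tail_x (i : 'I_m) : x`_(rshift k i) \in Y.
  by have := mem_tail _ i bxy; rewrite memv_cap => /andP[].
have tail_y (i : 'I_m) : y`_(rshift k i) \in X.
  have : basis_of (X :&: Y) (drop k y) by rewrite -xy.
  by move/(mem_tail _ i); rewrite memv_cap => /andP[].
have span_tail (i : 'I_m) : x'`_(rshift k i) \in <<drop k x>>%VS.
  by rewrite (span_basis bxy) mem_tail.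
have tail' (i : 'I_m) : x'`_(rshift k i) = y'`_(rshift k i).
  by rewrite !nth_tail xy'.
have PE : P = block_mx (ulsubmx P) (ursubmx P) 0 (drsubmx P).
  rewrite -{1}[P]submxK; congr block_mx; apply/matrixP=> i j; rewrite !mxE.
  by rewrite (coord_drop fx (span_tail i)) //= ltn_ord.
have QE : Q = block_mx (ulsubmx Q) (ursubmx Q) 0 (drsubmx P).
  rewrite -{1}[Q]submxK; congr block_mx; apply/matrixP=> i j; rewrite !mxE -tail'.
    by rewrite -(eq_coord_drop _ fx fy xy (span_tail i)) (coord_drop fx (span_tail i)) //= ltn_ord.
  by rewrite (eq_coord_drop _ fx fy xy (span_tail i)).
(* Tail vectors contribute nothing: the tails of x and y lie in both X and Y, which are
   isotropic. *)
have gramE : gram k x' y' = ulsubmx P *m gram k x y *m (ulsubmx Q)^T.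
  apply/matrixP=> i j; rewrite !mxE.
  rewrite (coord_basis bx (mem_x' (lshift m i))) (coord_basis by_ (mem_y' (lshift m j))).
  rewrite linear_sumr big_split_ord /= [X in _ + X]big1 ?addr0 => [|b _]; last first.
    rewrite linearZr_LR linear_sumlz big1 ?mulr0 // => a _.
    rewrite linearZl_LR [B _ _](isoX _ _ (mem_x a)) ?mulr0 //.
    exact: (tail_y b).
  apply: eq_bigr => b _; rewrite linearZr_LR linear_sumlz big_split_ord /=.
  rewrite [X in _ + X]big1 ?addr0 => [|a _]; last first.
    rewrite linearZl_LR [B _ _](isoY _ _ _ (mem_y (lshift m b))) ?mulr0 //.
    exact: (tail_x a).
  rewrite !mxE mulrC; congr (_ * _); apply: eq_bigr => a _.
  by rewrite linearZl_LR !mxE.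
have nzP : \det P != 0.
  have := determinant_function_neq0 df bx'; rewrite (determinant_function_basis df bx).
    by rewrite mulf_eq0 negb_or => /andP[].
  by move=> u; apply: basis_mem.
have nzQ : \det Q != 0.
  have := determinant_function_neq0 dg by'; rewrite (determinant_function_basis dg by_).
    by rewrite mulf_eq0 negb_or => /andP[].
  by move=> u; apply: basis_mem.
have detP : \det P = \det (ulsubmx P) * \det (drsubmx P) by rewrite {1}PE det_ublock.
have detQ : \det Q = \det (ulsubmx Q) * \det (drsubmx P) by rewrite {1}QE det_ublock.
(* The common block occurs once in [\det P] and once in [\det Q]; each upper left block occurs once
   there and once in the Gram determinant. *)
exists (\det (ulsubmx P) * \det (ulsubmx Q) * \det (drsubmx P)).
  move: nzP nzQ; rewrite detP detQ !mulf_eq0 !negb_or.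
  by move=> /andP[-> ->] /andP[->].
rewrite (determinant_function_basis df bx); last by move=> u; apply: basis_mem.
rewrite (determinant_function_basis dg by_); last by move=> u; apply: basis_mem.
rewrite -/P -/Q detP detQ gramE !det_mulmx det_tr; ring.
Qed.

(** A basis of the intersection is appended to bases of complements in X and in Y. *)
Lemma exists_adapted_bases n X Y :
  \dim X = n -> \dim Y = n -> exists x y, @adapted_bases F vT n X Y x y.
Proof.
move=> dX dY; set m := \dim (X :&: Y).
have bX : basis_of X (vbasis (X :\: Y) ++ vbasis (X :&: Y)).
  rewrite -{1}(addv_diff_cap X Y); apply: cat_basis; try exact: vbasisP.
  apply/directv_addP/eqP; rewrite -subv0 -(capv_diff X Y) capvS //.
  exact: capvSr.
have bY : basis_of Y (vbasis (Y :\: X) ++ vbasis (X :&: Y)).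
  rewrite capvC -{1}(addv_diff_cap Y X); apply: cat_basis; try exact: vbasisP.
  apply/directv_addP/eqP; rewrite -subv0 -(capv_diff Y X) capvS //.
  exact: capvSr.
have sX : size (vbasis (X :\: Y) ++ vbasis (X :&: Y)) == n.
  by rewrite size_cat !size_tuple addnC dimv_cap_compl dX.
have sY : size (vbasis (Y :\: X) ++ vbasis (X :&: Y)) == n.
  by rewrite size_cat !size_tuple addnC capvC dimv_cap_compl dY.
have distX : dist n X Y = size (vbasis (X :\: Y)).
  by rewrite size_tuple /dist -dX -(dimv_cap_compl X Y) addKn.
have distY : dist n X Y = size (vbasis (Y :\: X)).
  by rewrite size_tuple /dist -dY -(dimv_cap_compl Y X) capvC addKn.
exists (Tuple sX), (Tuple sY); apply/and4P; split=> //.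
  by rewrite {1}distX distY !drop_size_cat.
by rewrite distX drop_size_cat // vbasisP.
Qed.

Section Sigma.

Variables (n : nat) (delta : {vspace V} -> n.-tuple V -> F).
Hypothesis altB : alternating B.
Hypothesis deltaP :
  forall X, X \in lagrangians n B -> determinant_function X (@delta X).

Lemma lagrangiansP X :
  reflect (\dim X = n /\ totally_isotropic B X) (X \in lagrangians n B).
Proof. by rewrite inE; apply: (iffP andP) => -[/eqP]. Qed.

Lemma dist_le X Y : \dim X = n -> (dist n X Y + \dim (X :&: Y))%N = n.
Proof. by move=> dX; rewrite subnK // -[in X in (_ <= X)%N]dX dimvS ?capvSl. Qed.

Lemma alternating_skew x y : B x y = - B y x.
Proof.
have := altB (x + y); rewrite linearDr !linearDl !altB add0r addr0 addrC.
by move/eqP; rewrite addr_eq0 => /eqP.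
Qed.

Lemma eq_sigma_bases X Y x y x' y' :
  X \in lagrangians n B -> Y \in lagrangians n B ->
  adapted_bases X Y x y -> adapted_bases X Y x' y' ->
  exists2 c, c != 0 &
  delta X x' * delta Y y' * \det (gram (dist n X Y) x' y') =
    c ^+ 2 * (delta X x * delta Y y * \det (gram (dist n X Y) x y)).
Proof.
move=> LX LY; have [dX isoX] := lagrangiansP X LX.
have [dY isoY] := lagrangiansP Y LY.
have := deltaP LX; have := deltaP LY; have := dist_le Y dX.
(* Generalising the distance and the dimension lets [subst] replace [n] by [k + m], the form needed
   for block matrices. *)
rewrite /adapted_bases; move: (dist n X Y) (\dim (X :&: Y)) (delta X) (delta Y).
move=> k m f g nE; clear LX LY dX dY deltaP; subst n.
move=> dg df /and4P[bx by_ /eqP xy bxy] /and4P[bx' by' /eqP xy' bxy'].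
exact: (@det_gram_change k m X Y).
Qed.

(** The pair picked in [sigma] may be replaced by any adapted pair. *)
Lemma sigmaE X Y x y :
  X \in lagrangians n B -> Y \in lagrangians n B -> adapted_bases X Y x y ->
  sigma B delta X Y = quad_char (delta X x * delta Y y * \det (gram (dist n X Y) x y)).
Proof.
move=> LX LY axy; rewrite /sigma; case: pickP => [[x' y'] /= axy'|/(_ (x, y))/=].
  rewrite /sigma_bases; have [c c0 E] := eq_sigma_bases LX LY axy axy'.
  by rewrite -[RHS](quad_charMsq _ c0) -E.
by rewrite axy.
Qed.

Lemma adapted_basesC X Y x y :
  adapted_bases X Y x y -> @adapted_bases F vT n Y X y x.
Proof.
rewrite /adapted_bases /dist capvC => /and4P[bx by_ /eqP xy bxy].
by rewrite bx by_ -xy eqxx.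
Qed.

(** Since B is skew, the exchange multiplies the Gram determinant by (-1)^k, whose character is
    1. *)
Lemma sigmaC X Y :
  odd #|F| -> quad_char (-1 : F) = 1 ->
  X \in lagrangians n B -> Y \in lagrangians n B ->
  sigma B delta X Y = sigma B delta Y X.
Proof.
move=> oddF chiN1 LX LY.
have [[dX _] [dY _]] := (lagrangiansP X LX, lagrangiansP Y LY).
have [x [y axy]] := exists_adapted_bases dX dY.
rewrite (sigmaE LX LY axy) (sigmaE LY LX (adapted_basesC axy)).
have -> : dist n Y X = dist n X Y by rewrite /dist capvC.
have -> : gram (dist n X Y) y x = - (gram (dist n X Y) x y)^T.
  by apply/matrixP=> i j; rewrite !mxE alternating_skew.
rewrite -scaleN1r detZ det_tr mulrCA [delta Y y * _]mulrC !quad_charM //.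
suff -> : quad_char ((-1 : F) ^+ dist n X Y) = 1 by rewrite mul1r.
elim: (dist n X Y) => [|k IHk]; last by rewrite exprS quad_charM // IHk chiN1.
by rewrite expr0 -(expr1n _ 2) quad_char_sqr ?oner_eq0.
Qed.

End Sigma.
End SigmaBases.

(** * Nondegeneracy: [sigma] takes only the values 1 and -1 *)

Section Nondegenerate.

Import VectorInternalTheory.

Variables (F : finFieldType) (vT : vectType F).
Local Notation V := (finvect_type vT).
Variables (B : {biscalar V}) (n : nat).
Implicit Types X Y : {vspace V}.
Hypotheses (dimV : \dim {: V} = n.*2) (ndB : nondegenerate_form B).
Hypothesis altB : alternating B.

(** Dimension count: by nondegeneracy, pairing with a basis of Y has rank n, so the orthogonal of Y
    has dimension 2n - n. It contains Y and hence equals Y. *)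
Lemma lagrangian_ortho Y v :
  Y \in lagrangians n B -> {in Y, forall y, B v y = 0} -> v \in Y.
Proof.
case/lagrangiansP => dY /totally_isotropicP isoY vY.
have [y by_] : exists y : n.-tuple V, basis_of Y y.
  by rewrite -dY; exists (vbasis Y); apply: vbasisP.
have mem_y (i : 'I_n) : y`_i \in Y.
  by rewrite (basis_mem by_) // mem_nth ?size_tuple.
pose comb (u : 'rV[F]_n) := \sum_j u 0 j *: y`_j.
have comb_inj u : comb u = 0 -> u = 0.
  move=> u0; apply/rowP=> j; rewrite mxE.
  by rewrite -(coord_sum_free (u 0) j (basis_free by_)) -/(comb u) u0 linear0.
(* The kernel of [M] is the orthogonal of Y, and the row space of [C] below is Y itself. *)
pose M : 'M[F]_(dim V, n) := \matrix_(i, j) B (r2v (delta_mx 0 i)) y`_j.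
have mulM w (j : 'I_n) : (v2r w *m M) 0 j = B w y`_j.
  rewrite -[w in RHS]v2rK [v2r w in RHS]row_sum_delta linear_sum linear_sumlz !mxE.
  by apply: eq_bigr => i _; rewrite mxE linearZ linearZl_LR.
pose C : 'M[F]_(n, dim V) := \matrix_j v2r y`_j.
have mulC u : u *m C = v2r (comb u).
  rewrite mulmx_sum_row linear_sum; apply: eq_bigr => j _.
  by rewrite linearZ rowK.
have rankM : \rank M = n.
  rewrite -mxrank_tr; apply/eqP/inj_row_free => u uM; apply: comb_inj.
  apply: ndB => w; rewrite (alternating_skew altB) /comb linear_sumr.
  apply/eqP; rewrite oppr_eq0; apply/eqP.
  have /rowP/(_ 0): (v2r w *m M) *m u^T = 0.
    by rewrite -mulmxA -[M]trmxK -trmx_mul uM trmx0 mulmx0.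
  rewrite !mxE => uw; rewrite -[RHS]uw; apply: eq_bigr => j _.
  by rewrite mulM !mxE linearZr_LR mulrC.
have rankC : \rank C = n.
  apply/eqP/inj_row_free => u; rewrite mulC => /(congr1 r2v).
  by rewrite v2rK linear0 => /comb_inj.
have CM : (C <= kermx M)%MS.
  apply/sub_kermxP/row_matrixP=> i; rewrite row_mul rowK row0.
  by apply/rowP=> j; rewrite mulM mxE isoY.
have : (v2r v <= C)%MS.
  apply: (@submx_trans _ _ _ _ _ _ (kermx M)).
    by apply/sub_kermxP/rowP=> j; rewrite mulM mxE vY.
  rewrite -(mxrank_leqif_sup CM) mxrank_ker rankM rankC.
  by rewrite -[X in (_ == X - _)%N]dimvf dimV -addnn addnK.
case/submxP=> u; rewrite mulC => /(can_inj v2rK) ->.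
by apply: memv_suml => j _; apply: memvZ.
Qed.

(** A vector u in the left kernel gives a combination w of the first k vectors of x. It is
    orthogonal to the head of y by choice of u and to the tail because X is isotropic. So w lies in
    the intersection, where the first k coordinates vanish. *)
Lemma det_gram_neq0 k m p X Y (x y : p.-tuple V) : p = (k + m)%N ->
  X \in lagrangians n B -> Y \in lagrangians n B ->
  basis_of X x -> basis_of Y y -> drop k x = drop k y ->
  basis_of (X :&: Y) (drop k x) ->
  \det (gram B k x y) != 0.
Proof.
move=> pE; move: x y; rewrite pE => x y LX LY bx by_ xy bxy.
have /lagrangiansP[dX /totally_isotropicP isoX] := LX.
have mem_x (i : 'I_(k + m)) : x`_i \in X.
  by rewrite (basis_mem bx) // mem_nth ?size_tuple.
apply/det0P => -[u nz_u uG]; case/eqP: nz_u.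
pose w := \sum_(i < k + m) row_mx u 0 0 i *: x`_i.
have coord_w i : coord x i w = row_mx u 0 0 i.
  by rewrite coord_sum_free // (basis_free bx).
have wX : w \in X by apply: memv_suml => i _; apply: memvZ.
have wE : w = \sum_(i < k) u 0 i *: x`_i.
  rewrite /w big_split_ord /= [X in _ + X]big1 ?addr0 => [|i _].
    by apply: eq_bigr => i _; rewrite row_mxEl.
  by rewrite row_mxEr mxE scale0r.
have wY : w \in Y.
  apply: lagrangian_ortho => // v Yv; rewrite (coord_basis by_ Yv).
  rewrite linear_sumr big1 // => j _; rewrite linearZr_LR.
  case: (splitP j) => j' ->; last first.
    rewrite -nth_drop -xy isoX ?mulr0 //.
    have /(basis_mem bxy) : (drop k x)`_j' \in drop k x.
      by rewrite mem_nth // size_drop size_tuple addKn.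
    by rewrite memv_cap => /andP[].
  rewrite wE linear_sumlz; have /rowP/(_ j') := uG; rewrite !mxE => uGj.
  rewrite (eq_bigr (fun i => u 0 i * gram B k x y i j')) ?uGj ?mulr0 // => i _.
  by rewrite linearZl_LR mxE.
apply/rowP=> i; rewrite mxE -(row_mxEl u (0 : 'rV[F]_m)) -coord_w.
apply: (@coord_drop _ _ _ _ k) => //=; first exact: basis_free bx.
by rewrite (span_basis bxy) memv_cap wX.
Qed.

Lemma sigma_sign (delta : {vspace V} -> n.-tuple V -> F) X Y :
  (forall X, X \in lagrangians n B -> determinant_function X (@delta X)) ->
  X \in lagrangians n B -> Y \in lagrangians n B ->
  (sigma B delta X Y == 1) || (sigma B delta X Y == -1).
Proof.
move=> deltaP LX LY.
have [/lagrangiansP[dX _] /lagrangiansP[dY _]] := (LX, LY).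
have [x [y axy]] := exists_adapted_bases dX dY.
rewrite (sigmaE deltaP LX LY axy); apply: quad_char_unit.
have /and4P[bx by_ /eqP xy bxy] := axy.
apply: mulf_neq0; last first.
  exact: (det_gram_neq0 (esym (dist_le Y dX)) LX LY bx by_ xy bxy).
apply: mulf_neq0; first exact: (determinant_function_neq0 (deltaP _ LX)).
exact: (determinant_function_neq0 (deltaP _ LY)).
Qed.

End Nondegenerate.

(** * The effect of a semi-isometry on [sigma] *)

Section SemiIsometry.

Variables (F : finFieldType) (vT : vectType F).
Local Notation V := (finvect_type vT).
Variables (B : {biscalar V}) (g : {perm V}).
Hypothesis Gg : g \in SigmaSp B.
Local Notation im X := (vspace_im B X g).
Implicit Types X Y : {vspace V}.

(** The field automorphism, so far a bare permutation, is packed as a ring morphism so that it can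
    be applied to matrices and determinants. *)
Lemma SigmaSp_rmorph :
  exists tau : {rmorphism F -> F},
    [/\ bijective tau, {morph g : x y / x + y},
        forall a x, g (a *: x) = tau a *: g x
      & forall x y, B (g x) (g y) = tau (B x y)].
Proof.
have /SigmaSpP[tau [/and3P[/eqP t1 tD tM] gD gZ gB]] := Gg.
have {}tD a b : tau (a + b) = tau a + tau b by apply/eqP/('forall_forallP tD).
have {}tM a b : tau (a * b) = tau a * tau b by apply/eqP/('forall_forallP tM).
have t0 : tau 0 = 0 by apply: (addrI (tau 0)); rewrite -tD !addr0.
have tB : zmod_morphism tau.
  move=> a b; apply: (addIr (tau b)); rewrite -tD !subrK //.
pose t := HB.pack_for {rmorphism F -> F} (tau : F -> F)
  (GRing.isZmodMorphism.Build F F tau tB)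
  (GRing.isMonoidMorphism.Build F F tau (t1, tM)).
exists t; split=> //; apply: (Bijective (permK tau) (permKV tau)).
Qed.

Lemma memv_im X x : (g x \in im X) = (x \in X).
Proof. by rewrite mem_vspace_im // permK. Qed.

Lemma vspace_im_cap X Y : im (X :&: Y) = (im X :&: im Y)%VS.
Proof. by apply/vspaceP=> y; rewrite memv_cap !mem_vspace_im // memv_cap. Qed.

Section WithTau.

Variable tau : {rmorphism F -> F}.
Hypotheses (tau_bij : bijective tau) (gD : {morph g : x y / x + y}).
Hypothesis gZ : forall a x, g (a *: x) = tau a *: g x.

Lemma semilinear0 : g 0 = 0.
Proof. by apply: (addIr (g 0)); rewrite -gD !add0r. Qed.

Lemma semilinear_comb m (c : 'I_m -> F) (x : 'I_m -> V) :
  g (\sum_i c i *: x i) = \sum_i tau (c i) *: g (x i).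
Proof.
rewrite (big_morph g gD semilinear0); exact: eq_bigr.
Qed.

Lemma basis_of_im X m (x : m.-tuple V) :
  basis_of X x -> basis_of (im X) (map_tuple g x).
Proof.
move=> bx; have [tau' tauK tau'K] := tau_bij.
have nth_g (i : 'I_m) : (map_tuple g x)`_i = g x`_i.
  by rewrite (nth_map 0) // size_tuple.
apply/andP; split; last first.
  apply/freeP => c.
  (* Coefficients are pulled back through the inverse of [tau], so that the relation becomes the
     image under [g] of a relation among the x_i. *)
  rewrite (eq_bigr (fun i => tau (tau' (c i)) *: g x`_i)); last first.
    by move=> i _; rewrite nth_g tau'K.
  rewrite -semilinear_comb => gc0 i.
  have c0 : \sum_i tau' (c i) *: x`_i = 0.
    by apply: (@perm_inj _ g); rewrite semilinear0.
  have /freeP/(_ _ c0 i) ci0 := basis_free bx.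
  by rewrite -[c i]tau'K ci0 rmorph0.
rewrite eqEsubv; apply/andP; split.
  by apply/span_subvP => y /mapP[u xu ->]; rewrite memv_im (basis_mem bx).
apply/subvP => y; rewrite -[y](permKV g) memv_im => /(coord_basis bx) ->.
rewrite semilinear_comb; apply: memv_suml => i _; apply/memvZ/memv_span.
by rewrite -nth_g mem_nth // size_tuple.
Qed.

Lemma dimv_im X : \dim (im X) = \dim X.
Proof.
have /basis_of_im/span_basis imX := vbasisP X.
have /basis_of_im/basis_free := vbasisP X.
by rewrite /free imX size_tuple => /eqP.
Qed.

Lemma coord_im X n (x : n.-tuple V) i v :
  basis_of X x -> v \in X -> coord (map_tuple g x) i (g v) = tau (coord x i v).
Proof.
move=> bx Xv; rewrite {1}(coord_basis bx Xv) semilinear_comb.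
rewrite -(coord_sum_free (fun j => tau (coord x j v)) i (basis_free (basis_of_im bx))).
by congr coord; apply: eq_bigr => j _; rewrite (nth_map 0) // size_tuple.
Qed.

Hypothesis gB : forall x y, B (g x) (g y) = tau (B x y).
Variables (n : nat) (delta : {vspace V} -> n.-tuple V -> F).
Hypothesis deltaP :
  forall X, X \in lagrangians n B -> determinant_function X (@delta X).

Lemma lagrangians_im X : X \in lagrangians n B -> im X \in lagrangians n B.
Proof.
case/lagrangiansP=> dX /totally_isotropicP isoX; apply/lagrangiansP.
split; first by rewrite dimv_im.
apply/totally_isotropicP => u v; rewrite -[u](permKV g) -[v](permKV g) !memv_im.
by move=> Xu Xv; rewrite gB isoX // rmorph0.
Qed.

Lemma dist_im X Y : dist n (im X) (im Y) = dist n X Y.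
Proof. by rewrite /dist -vspace_im_cap dimv_im. Qed.

Lemma adapted_bases_im X Y x y :
  adapted_bases X Y x y ->
  @adapted_bases F vT n (im X) (im Y) (map_tuple g x) (map_tuple g y).
Proof.
case/and4P=> bx by_ /eqP xy bxy; rewrite /adapted_bases !basis_of_im //=.
rewrite dist_im -vspace_im_cap -!map_drop xy eqxx -xy.
exact: (@basis_of_im _ _ (in_tuple _)).
Qed.

Lemma gram_im k (x y : n.-tuple V) : (k <= n)%N ->
  gram B k (map_tuple g x) (map_tuple g y) = map_mx tau (gram B k x y).
Proof.
move=> kn; apply/matrixP=> i j; rewrite !mxE !(nth_map 0) ?gB // size_tuple.
  exact: leq_trans kn.
exact: leq_trans kn.
Qed.

Hypothesis oddF : odd #|F|.

(* The scalar by which [g] distorts the determinant functions is determined,  *)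
(* up to squares, by X alone.                                                 *)
Lemma quad_char_delta_im X (x x' : n.-tuple V) :
  X \in lagrangians n B -> basis_of X x -> basis_of X x' ->
  quad_char (delta (im X) (map_tuple g x') * delta X x') =
  quad_char (delta (im X) (map_tuple g x) * delta X x).
Proof.
move=> LX bx bx'; have [LX' bx1] := (lagrangians_im LX, basis_of_im bx).
have Xx' : {subset x' <= X} by move=> u; apply: basis_mem.
have gXx' : {subset map_tuple g x' <= im X}.
  by move=> u; apply: basis_mem (basis_of_im bx').
rewrite (determinant_function_basis (deltaP LX') bx1) //.
rewrite (determinant_function_basis (deltaP LX) bx) //.
have -> : coord_mx (map_tuple g x) (map_tuple g x') = map_mx tau (coord_mx x x').
  apply/matrixP=> i j; rewrite !mxE (nth_map 0) ?size_tuple // (coord_im _ bx) //.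
  by rewrite Xx' // mem_nth ?size_tuple.
set d := \det (coord_mx x x'); rewrite det_map_mx -/d.
have d0 : d != 0.
  have := determinant_function_neq0 (deltaP LX) bx'.
  by rewrite (determinant_function_basis (deltaP LX) bx) // mulf_eq0 => /norP[].
(* The change of basis contributes [tau d * d], with character the square of that of [d]. *)
rewrite mulrACA !quad_charM // quad_char_rmorph -quad_charM //.
by rewrite -expr2 quad_char_sqr // mul1r.
Qed.

(** The sign [e X] compares the determinant functions of X and its image on one basis; any basis
    gives the same sign. The Gram determinant is only moved by [tau]. *)
Lemma sigma_im :
  exists e : {vspace V} -> int,
    {in lagrangians n B, forall X, e X ^+ 2 = 1} /\
    {in lagrangians n B &, forall X Y,
       sigma B delta (im X) (im Y) = e X * e Y * sigma B delta X Y}.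
Proof.
(* The zero tuple is a default for subspaces of dimension other than n, hence never met on
   Lagrangians. *)
pose x0 X : n.-tuple V := insubd [tuple of nseq n 0] (vbasis X : seq V).
have x0P X : X \in lagrangians n B -> basis_of X (x0 X).
  case/lagrangiansP=> dX _; rewrite /x0 val_insubd ifT ?vbasisP //.
  by rewrite size_tuple dX.
pose e X := quad_char (delta (im X) (map_tuple g (x0 X)) * delta X (x0 X)).
have e2 X : X \in lagrangians n B -> e X ^+ 2 = 1.
  move=> LX; have bx := x0P X LX.
  have : (e X == 1) || (e X == -1).
    apply: quad_char_unit; apply: mulf_neq0.
      exact: (determinant_function_neq0 (deltaP (lagrangians_im LX)) (basis_of_im bx)).
    exact: (determinant_function_neq0 (deltaP LX)).
  by case/orP=> /eqP->.
have eE X (x : n.-tuple V) : X \in lagrangians n B -> basis_of X x ->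
    quad_char (delta (im X) (map_tuple g x)) = e X * quad_char (delta X x).
  move=> LX bx; rewrite /e -(quad_char_delta_im LX (x0P X LX) bx).
  rewrite quad_charM // -mulrA -quad_charM // -expr2 quad_char_sqr ?mulr1 //.
  exact: (determinant_function_neq0 (deltaP LX)).
exists e; split=> // X Y LX LY.
have [[dX _] [dY _]] := (lagrangiansP _ _ _ LX, lagrangiansP _ _ _ LY).
have [x [y axy]] := exists_adapted_bases dX dY.
have /and4P[bx by_ _ _] := axy.
rewrite (sigmaE deltaP LX LY axy).
rewrite (sigmaE deltaP (lagrangians_im LX) (lagrangians_im LY) (adapted_bases_im axy)).
rewrite dist_im.
rewrite gram_im ?leq_subr // det_map_mx !quad_charM // quad_char_rmorph.
rewrite !eE //; ring.
Qed.

End WithTau.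
End SemiIsometry.

(** * Triviality of the action of -I *)

Section MinusIdentity.

Variables (F : finFieldType) (vT : vectType F) (B : {biscalar finvect_type vT}).

Lemma minus_id_SigmaSp : minus_id vT \in SigmaSp B.
Proof.
apply/SigmaSpP; exists 1%g; split=> *; rewrite ?perm1 ?permE ?opprD ?scalerN //.
  by apply/and3P; split; rewrite ?perm1 //; apply/'forall_forallP=> *; rewrite !perm1.
by rewrite linearNl linearN opprK.
Qed.

(** Subspaces are closed under negation, so -I stabilises X; the stabiliser is a group and thus
    contains all that -I generates. *)
Lemma vspace_im_minus_id X g :
  g \in <[minus_id vT]>%g -> vspace_im B X g = X.
Proof.
move=> Mg; have Gm := minus_id_SigmaSp.
have Cm : (minus_id vT \in 'C([set X] | vspace_action B))%g.
  rewrite in_setI Gm in_set sub1set in_set; apply/eqP/vspaceP=> x.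
  have -> : x = minus_id vT (- x) by rewrite permE opprK.
  by rewrite /= mem_vspace_im // permK permE opprK memvN.
apply: (astab_act (to := vspace_action B) (S := [set X])); last exact: set11.
by apply: subsetP Mg; rewrite cycle_subG.
Qed.

End MinusIdentity.

Theorem theorem4p4 (n : nat) (F : finFieldType) (vT : vectType F)
    (B : {biscalar (finvect_type vT)})
    (delta : {vspace finvect_type vT} -> n.-tuple (finvect_type vT) -> F)
    (n_gt0 : (0 < n)%N)
    (cardF : #|F| = 1 %[mod 4])
    (dimV : \dim {: finvect_type vT} = n.*2)
    (altB : alternating B)
    (ndB : nondegenerate_form B)
    (deltaP : forall X, X \in lagrangians n B -> determinant_function X (@delta X)) :
  two_graph (lagrangians n B) (coherent_triples B delta) /\
  [acts PSigmaSp B, on coherent_triples B delta |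
    (vspace_action B %% <[minus_id vT]>)^*].
Proof.
have oddF : odd #|F|.
  by rewrite (divn_eq #|F| 4) oddD oddM andbF cardF.
have DE : coherent_triples B delta =
          positive_triples (lagrangians n B) (sigma B delta) by [].
split.
  rewrite DE; apply: two_graph_positive_triples => X Y LX LY.
    exact: sigmaC (quad_charN1 oddF cardF) LX LY.
  by move=> _; exact: sigma_sign.
apply/subsetP=> _ /morphimP[g Ng Gg ->].
rewrite inE; apply/andP; split; first by apply: mem_morphim.
rewrite DE in_set; apply/subsetP=> S DS; rewrite in_set /= /setact.
(* A coset acts through any representative, as the subgroup factored out fixes every subspace. *)
have imE X : (vspace_action B %% <[minus_id vT]>)%act X (coset <[minus_id vT]> g) =
             vspace_im B X g.
  apply: modactE => //; apply/afixP=> h /setIP[_]; exact: vspace_im_minus_id.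
case/positive_triplesP: DS => X [Y [Z [[LX LY LZ] uXYZ sXYZ ->]]].
have [tau [tau_bij gD gZ gB]] := SigmaSp_rmorph Gg.
have [e [e2 sigmaE]] := sigma_im Gg tau_bij gD gZ gB deltaP oddF.
have imL := lagrangians_im Gg tau_bij gD gZ gB.
apply/positive_triplesP.
exists (vspace_im B X g), (vspace_im B Y g), (vspace_im B Z g); split.
- by split; apply: imL.
- by rewrite -(map_inj_uniq (act_inj (vspace_action B) g)) in uXYZ.
- rewrite !sigmaE //.
  (* Each Lagrangian belongs to two pairs of the triple, so its sign enters squared. *)
  transitivity (e X ^+ 2 * e Y ^+ 2 * e Z ^+ 2 *
    (sigma B delta X Y * sigma B delta Y Z * sigma B delta Z X)); first by ring.
  by rewrite !e2 // sXYZ !mul1r.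
by rewrite !imsetU !imset_set1 !imE.
Qed.
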